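(* Let $\mu$ be a unimodular probability measure on $\mathcal G_\ast$ such that $\deg_G(o)>0$ for $\mu$-a.e. $[G,o]$ and such that, for some $D\in\mathbb N$, $\deg_G(v)\le D$ for all $v\in V(G)$ for $\mu$-a.e. $[G,o]$. Let $\eta\in L^2(\mu,\mathbb R)$ and consider the game with action set $\mathbb R$, private cost $f([G,o],a)=-\eta([G,o])\,a$ and interaction cost $h([G,o,v],a,b)=\frac12(a-b)^2$. Assume that for $\mu$-a.e. $[G,o]$ the simple random walk operator $P_G$ satisfies $\rho(P_G)<1$, and that $\xi^G$ defined by $\xi^G_v=\eta([G,v])/\deg_G(v)$, $v\in V(G)$, belongs to $\ell^2(V(G),m_G)$. Then (for $\mu$-a.e. $[G,o]$) the Green kernel $K_G$ defines a bounded linear operator on $\ell^2(V(G),m_G)$, and if $x^\ast\in\mathcal H=L^2(\mu,\mathbb R)$ is given by $x^\ast([G,v])=x^{\ast,G}_v$ with $$x^{\ast,G}_v=\sum_{u\in V(G)}K_G(v,u)\,\xi^G_u,\qquad v\in V(G),$$ then $x^\ast$ is a quenched Nash equilibrium.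
   Context: Graphs. All graphs $G=(V,E)$ are simple (undirected, no loops or multiple edges), locally finite, with finite or countably infinite vertex set $V=V(G)$; $u\sim v$ means $\{u,v\}\in E$. A rooted graph $(G,o)$ is a graph with a distinguished vertex $o$; rooted isomorphisms are graph isomorphisms mapping root to root, and $[G,o]$ is the isomorphism class. $B_r(G,o)$ is the rooted subgraph induced by the vertices at graph distance at most $r$ from $o$. $\mathcal G_\ast$ is the set of isomorphism classes of countable, connected, rooted graphs with metric $d_\ast([G,o],[G',o'])=\inf_{r\in\mathbb N_0}\{2^{-r}:B_r(G,o)\cong B_r(G',o')\}$. $\mathcal G_{\ast\ast}$ is the analogous space of isomorphism classes $[G,o_1,o_2]$ of countable, connected, doubly rooted graphs (isomorphisms preserve both roots in order), with the analogous metric $d_{\ast\ast}$. Both carry Borel $\sigma$-fields. A probability measure $\mu$ on $\mathcal G_\ast$ is unimodular if for every measurable $T:\mathcal G_{\ast\ast}\to[0,\infty]$, $\int\sum_{v\in V(G)}T([G,o,v])\,\mu(d[G,o])=\int\sum_{v\in V(G)}T([G,v,o])\,\mu(d[G,o])$. Random walk. For a graph $G$ in the support of $\mu$, the simple random walk on $G$ is the Markov chain on $V(G)$ with transition probabilities $p_G(v,u)=1/\deg_G(v)$ if $u\sim v$ and $0$ otherwise; $p_G^{(n)}(v,u)$ denotes its $n$-step transition probabilities. Let $m_G(v)=\deg_G(v)$, a measure on $V(G)$, and $\ell^2(V(G),m_G)$ the corresponding weighted real $\ell^2$ space. The simple random walk operator on $\ell^2(V(G),m_G)$ is $(P_G\xi)(v)=\frac1{\deg_G(v)}\sum_{u\sim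 v}\xi(u)$. Its spectral radius is $\rho(P_G)=\limsup_{n\to\infty}p_G^{(n)}(v,u)^{1/n}\in(0,1]$, which does not depend on $v,u\in V(G)$. The Green kernel is $K_G(v,u)=\sum_{n=0}^\infty p_G^{(n)}(v,u)$; as an operator, $(K_G\xi)(v)=\sum_{u\in V(G)}K_G(v,u)\xi(u)$. Game. $\mathcal H=L^2(\mu,\mathbb R)$ is the space of square-$\mu$-integrable measurable $x:\mathcal G_\ast\to\mathbb R$. For such $x$ and a countable connected graph $G$, write $x^G_v=x([G,v])$ and $x^G=(x^G_v)_{v\in V(G)}$. The cost of player $v\in V(G)$ is $J^G_v(x^G)=f([G,v],x^G_v)+\sum_{u\sim v}h([G,v,u],x^G_v,x^G_u)$. An element $x\in\mathcal H$ is a quenched Nash equilibrium if for $\mu$-a.e. $[G,o]$, $J^G_o(x^G)\le J^G_o(a,x^G_{-o})$ for all $a\in\mathbb R$, where $(a,x^G_{-o})$ is $x^G$ with the root action $x^G_o$ replaced by $a$. *)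

(* Defs.v *)
From HB Require Import structures.
From mathcomp Require Import all_boot all_order all_algebra.
From mathcomp Require Import generic_quotient.
From mathcomp Require Import finmap.
From mathcomp Require Import all_classical all_reals all_analysis.
From mathcomp Require Import measurable_realfun.

Set Implicit Arguments.
Unset Strict Implicit.
Unset Printing Implicit Defensive.
Import Order.TTheory GRing.Theory Num.Theory.
Import numFieldNormedType.Exports.

Local Open Scope classical_set_scope.
Local Open Scope ring_scope.
Local Open Scope quotient_scope.

(* A countable graph is isomorphic to one whose vertices are natural numbers;
   taking vertex sets in [nat] makes the isomorphism classes form a type.
   Every graph considered below is connected, so this is a field too. *)
Record graph := Graph {
  vset : pred nat;
  adj : rel {n : nat | vset n};
  adj_sym : symmetric adj;
  adj_irr : irreflexive adj;
  adj_finite : forall v, finite_set [set u | adj v u];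
  adj_connected : forall u v, exists2 p, path adj u p & last u p = v }.

Definition vertex (G : graph) : Type := {n : nat | vset G n}.
Coercion vertex : graph >-> Sortclass.
HB.instance Definition _ (G : graph) := Countable.on (vertex G).

Definition nbrs (G : graph) (v : G) : set G := [set u | adj v u].

Definition deg (G : graph) (v : G) : nat := #|` fset_set (nbrs v)|%fset.

(* [k = 1] gives rooted and [k = 2] doubly rooted graphs. *)
Record rooted (k : nat) := Rooted {
  ggraph : graph;
  groots : k.-tuple ggraph }.
HB.instance Definition _ k := gen_eqMixin (rooted k).
HB.instance Definition _ k := gen_choiceMixin (rooted k).

Section isomorphism.
Variable k : nat.
Implicit Types X Y Z : rooted k.

Definition isomorphic X Y : Prop :=
  exists f : ggraph X -> ggraph Y, [/\ bijective f,
    forall u v, adj (f u) (f v) = adj u v &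
    forall i, f (tnth (groots X) i) = tnth (groots Y) i].

Lemma isomorphic_refl X : isomorphic X X.
Proof. by exists id; split=> //; exists id. Qed.

Lemma isomorphic_sym X Y : isomorphic X Y -> isomorphic Y X.
Proof.
move=> [f [[g fg gf] fE fr]]; exists g; split; first by exists f.
  by move=> u v; rewrite -fE !gf.
by move=> i; rewrite -fr fg.
Qed.

Lemma isomorphic_trans Y X Z :
  isomorphic X Y -> isomorphic Y Z -> isomorphic X Z.
Proof.
move=> [f [fb fE fr]] [g [gb gE gr]]; exists (g \o f); split.
- exact: bij_comp.
- by move=> u v /=; rewrite gE fE.
- by move=> i /=; rewrite fr gr.
Qed.

Definition iso X Y : bool := `[< isomorphic X Y >].

Lemma iso_equiv_class : equiv_class_of iso.
Proof.
split.
- by move=> X; apply/asboolP; exact: isomorphic_refl.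
- by move=> X Y; apply/asboolP/asboolP; exact: isomorphic_sym.
- by move=> Y X Z /asboolP XY /asboolP YZ; apply/asboolP;
    exact: isomorphic_trans XY YZ.
Qed.

Canonical iso_equiv := EquivRelPack iso_equiv_class.

(* vertices at graph distance at most [r] from some root *)
Definition rball X (r : nat) : set (ggraph X) :=
  [set v | exists i, exists p, [/\ path (@adj _) (tnth (groots X) i) p,
     last (tnth (groots X) i) p = v & (size p <= r)%N]].
Arguments rball : clear implicits.

(* isomorphism of the subgraphs induced by the balls of radius [r] *)
Definition ball_isomorphic (r : nat) X Y : Prop :=
  exists f : rball X r -> rball Y r, [/\ bijective f,
    forall u v, adj (val (f u)) (val (f v)) = adj (val u) (val v) &
    forall i u, val u = tnth (groots X) i -> val (f u) = tnth (groots Y) i].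

Lemma root_rball X r i : rball X r (tnth (groots X) i).
Proof. by exists i, [::]. Qed.

Lemma rballS X r s : (r <= s)%N -> rball X r `<=` rball X s.
Proof.
by move=> rs v [i [p [? ? pr]]]; exists i, p; split=> //; exact: leq_trans rs.
Qed.

Lemma ball_isomorphic_refl r X : ball_isomorphic r X X.
Proof. by exists id; split=> //; exists id. Qed.

Lemma ball_isomorphic_sym r X Y : ball_isomorphic r X Y -> ball_isomorphic r Y X.
Proof.
move=> [f [[g fg gf] fE fr]]; exists g; split; first by exists f.
  by move=> u v; rewrite -fE !gf.
move=> i u ui; pose u0 : rball X r := SigSub (mem_set (@root_rball X r i)).
suff -> : u = f u0 by rewrite fg.
by apply: val_inj; rewrite ui; apply/esym/fr.
Qed.

Lemma ball_isomorphic_trans r Y X Z :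
  ball_isomorphic r X Y -> ball_isomorphic r Y Z -> ball_isomorphic r X Z.
Proof.
move=> [f [fb fE fr]] [g [gb gE gr]]; exists (g \o f); split.
- exact: bij_comp.
- by move=> u v /=; rewrite gE fE.
- by move=> i u ui /=; apply/gr/fr.
Qed.

Lemma rball_image r s X Y (f : rball X r -> rball Y r) :
  (s <= r)%N ->
  (forall u v, adj (val (f u)) (val (f v)) = adj (val u) (val v)) ->
  (forall i u, val u = tnth (groots X) i -> val (f u) = tnth (groots Y) i) ->
  forall u, rball X s (val u) -> rball Y s (val (f u)).
Proof.
move=> + fE fr; elim: s => [|s IH] sr u [i [p [pp pl ps]]].
  by exists i, [::]; split=> //=; apply/esym/fr; rewrite -pl;
    move: ps; rewrite leqn0 => /nilP ->.
case/lastP: p pp pl ps => [|p x] pp pl ps.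
  by exists i, [::]; split=> //=; apply/esym/fr; rewrite -pl.
move: pp; rewrite rcons_path => /andP[pp px].
move: pl ps; rewrite last_rcons size_rcons ltnS => xu ps.
have ws : rball X s (last (tnth (groots X) i) p) by exists i, p.
pose w : rball X r := SigSub (mem_set (rballS (ltnW sr) ws)).
have [j [q [qp ql qs]]] := IH (ltnW sr) w ws.
exists j, (rcons q (val (f u))); split; last by rewrite size_rcons ltnS.
  by rewrite rcons_path qp/= ql fE -xu.
by rewrite last_rcons.
Qed.

Lemma ball_isomorphicW r s X Y :
  (s <= r)%N -> ball_isomorphic r X Y -> ball_isomorphic s X Y.
Proof.
move=> sr XY; have [f [[g fg gf] fE fr]] := XY.
have gE u v : adj (val (g u)) (val (g v)) = adj (val u) (val v).
  by rewrite -fE !gf.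
have gr i u : val u = tnth (groots Y) i -> val (g u) = tnth (groots X) i.
  move=> ui; pose u0 : rball X r := SigSub (mem_set (@root_rball X r i)).
  suff -> : u = f u0 by rewrite fg.
  by apply: val_inj; rewrite ui; apply/esym/fr.
pose wX (u : rball X s) : rball X r :=
  SigSub (mem_set (rballS sr (set_mem (valP u)))).
pose wY (u : rball Y s) : rball Y r :=
  SigSub (mem_set (rballS sr (set_mem (valP u)))).
pose F (u : rball X s) : rball Y s :=
  SigSub (mem_set (@rball_image r s _ _ f sr fE fr (wX u) (set_mem (valP u)))).
pose H (u : rball Y s) : rball X s :=
  SigSub (mem_set (@rball_image r s _ _ g sr gE gr (wY u) (set_mem (valP u)))).
exists F; split.
- exists H => u; apply: val_inj => /=.
    by rewrite (_ : wY (F u) = f (wX u)) ?fg//; exact: val_inj.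
  by rewrite (_ : wX (H u) = g (wY u)) ?gf//; exact: val_inj.
- by move=> u v; rewrite /= fE.
- by move=> i u ui; exact: (fr i (wX u) ui).
Qed.

End isomorphism.

(* The parameter [R] only carries the real numbers in which distances are
   measured. *)
Definition Gspace (R : realType) (k : nat) : Type := {eq_quot (iso_equiv k)}.
HB.instance Definition _ (R : realType) k := Choice.on (Gspace R k).

Notation Gstar R := (Gspace R 1).
Notation Gstarstar R := (Gspace R 2).

Definition gclass (R : realType) k (G : graph) (r : k.-tuple G) : Gspace R k :=
  \pi_{eq_quot (iso_equiv k)} (Rooted r).
Definition grepr (R : realType) k (X : Gspace R k) : rooted k :=
  repr (X : {eq_quot (iso_equiv k)}).

(* [[G, o]] and [[G, o, v]] *)
Definition class1 {R : realType} (G : graph) (o : G) : Gstar R :=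
  gclass R [tuple o].
Definition class2 {R : realType} (G : graph) (o v : G) : Gstarstar R :=
  gclass R [tuple o; v].

Definition groot {R : realType} (X : Gstar R) : ggraph (grepr X) :=
  tnth (groots (grepr X)) ord0.

Section local_topology.
Variables (R : realType) (k : nat).
Implicit Types X Y Z : Gspace R k.

(* For [k = 2] this is [+oo] when not even the balls of radius 0 match. *)
Definition local_dist X Y : \bar R :=
  ereal_inf [set ((2^-1 : R) ^+ r)%:E |
             r in [set r | ball_isomorphic r (grepr X) (grepr Y)]].

Definition local_ball X (e : R) : set (Gspace R k) :=
  [set Y | (local_dist X Y < e%:E)%E].

Lemma local_ballP X e Y : local_ball X e Y <->
  exists2 r, ball_isomorphic r (grepr X) (grepr Y) & (2^-1 : R) ^+ r < e.
Proof.
split=> [/ereal_inf_lt[_ [r XY <-]]|[r XY re]]; first by rewrite lte_fin; exists r.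
apply: (@le_lt_trans _ _ ((2^-1 : R) ^+ r)%:E); last by rewrite lte_fin.
by apply: ereal_inf_lbound; exists r.
Qed.

Let ent := entourage_ local_ball.

Let local_nbhs X : set_system (Gspace R k) := nbhs_ ent X.

Let local_nbhsE : local_nbhs = nbhs_ ent. Proof. by []. Qed.

HB.instance Definition _ := hasNbhs.Build (Gspace R k) local_nbhs.

Let local_ball_center X (e : R) : 0 < e -> local_ball X e X.
Proof.
move=> e0; have [r re] : exists r, (2^-1 : R) ^+ r < e.
  have /cvgrPdist_lt/(_ e e0)[r _ /(_ r (leqnn r))] :
      (fun n => (2^-1 : R) ^+ n) @ \oo --> (0 : R).
    by apply: cvg_expr; rewrite ger0_norm ?invr_ge0// invf_lt1 ?ltr1n.
  by rewrite /= sub0r normrN ger0_norm ?exprn_ge0 ?invr_ge0//; exists r.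
by apply/local_ballP; exists r => //; exact: ball_isomorphic_refl.
Qed.

Let local_ball_sym X Y (e : R) : local_ball X e Y -> local_ball Y e X.
Proof.
by move=> /local_ballP[r XY re]; apply/local_ballP; exists r => //;
  exact: ball_isomorphic_sym.
Qed.

Let local_ball_triangle X Y Z (e1 e2 : R) :
  local_ball X e1 Y -> local_ball Y e2 Z -> local_ball X (e1 + e2) Z.
Proof.
move=> /local_ballP[r XY re] /local_ballP[s YZ se]; apply/local_ballP.
have p2 n : 0 < (2^-1 : R) ^+ n by rewrite exprn_gt0 ?invr_gt0.
have e10 := lt_trans (p2 _) re; have e20 := lt_trans (p2 _) se.
have [rs|/ltnW sr] := leqP r s.
  exists r; last by rewrite (lt_trans re)// ltrDl.
  exact: ball_isomorphic_trans XY (ball_isomorphicW rs YZ).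
exists s; last by rewrite (lt_trans se)// ltrDr.
exact: ball_isomorphic_trans (ball_isomorphicW sr XY) YZ.
Qed.

Let local_entE : ent = entourage_ local_ball. Proof. by []. Qed.

HB.instance Definition _ := @Nbhs_isPseudoMetric.Build R (Gspace R k)
  ent local_nbhsE local_ball local_ball_center local_ball_sym
  local_ball_triangle local_entE.

Definition trivial_graph : graph.
Proof.
apply: (@Graph (pred1 0%N) (fun _ _ => false)) => //.
  by move=> v; rewrite (_ : mkset _ = set0) //; apply/seteqP; split.
move=> u v; exists [::] => //=; apply: val_inj.
by rewrite (eqP (valP u)) (eqP (valP v)).
Defined.

HB.instance Definition _ := isPointed.Build (Gspace R k)
  (gclass R [tuple (exist _ 0%N isT : trivial_graph) | _ < k]).

(* Borel sigma-algebra *)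
HB.instance Definition _ := @isMeasurable.Build
  (sigma_display (@open (Gspace R k))) (Gspace R k)
  <<s @open (Gspace R k) >> (@sigma_algebra0 _ setT _)
  (@sigma_algebraC _ _) (@sigma_algebra_bigcup _ setT _).

End local_topology.

(* [P] holds for [mu]-almost every [[G, o]]; quantifying over all the
   representatives of a class, [P] need not be known to be invariant. *)
Definition ae_rooted (R : realType) (mu : probability (Gstar R) R)
    (P : forall G : graph, G -> Prop) : Prop :=
  {ae mu, forall X : Gstar R, forall (G : graph) (o : G), X = class1 o -> P G o}.

Definition unimodular (R : realType) (mu : probability (Gstar R) R) : Prop :=
  forall T : Gstarstar R -> \bar R,
    measurable_fun setT T -> (forall X, (0 <= T X)%E) ->
    (\int[mu]_X (\esum_(v in [set: ggraph (grepr X)]) T (class2 (groot X) v)) =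
     \int[mu]_X (\esum_(v in [set: ggraph (grepr X)]) T (class2 v (groot X))))%E.

Section random_walk.
Variables (R : realType) (G : graph).
Implicit Types (u v w : G) (xi : G -> R).

Definition step v u : R := if adj v u then (deg v)%:R^-1 else 0.

Fixpoint nstep (n : nat) v u : R :=
  if n is m.+1 then \sum_(w \in [set: G]) step v w * nstep m w u
  else (v == u)%:R.

Definition rho v u : \bar R :=
  limn_esup (fun n => (nstep n v u `^ (n%:R^-1))%:E).

Definition green v u : \bar R := (\sum_(0 <= n <oo) (nstep n v u)%:E)%E.

Definition in_l2 xi : Prop :=
  (\esum_(v in [set: G]) ((deg v)%:R * xi v ^+ 2)%:E < +oo)%E.

Definition l2norm xi : R :=
  Num.sqrt (fine (\esum_(v in [set: G]) ((deg v)%:R * xi v ^+ 2)%:E)%E).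

(* [\esum] is for nonnegative families; this is the sum of a summable one. *)
Definition vsum (F : G -> \bar R) : \bar R :=
  (\esum_(u in [set: G]) F^\+ u - \esum_(u in [set: G]) F^\- u)%E.

Definition green_op xi v : R := fine (vsum (fun u => green v u * (xi u)%:E)%E).

Definition green_bounded : Prop :=
  [/\ forall xi, in_l2 xi -> forall v,
        summable [set: G] (fun u => green v u * (xi u)%:E)%E,
      forall xi, in_l2 xi -> in_l2 (green_op xi),
      forall (a : R) xi zeta, in_l2 xi -> in_l2 zeta ->
        green_op (fun v => a * xi v + zeta v) =
        (fun v => a * green_op xi v + green_op zeta v) &
      exists C : R, forall xi, in_l2 xi ->
        l2norm (green_op xi) <= C * l2norm xi].

End random_walk.

Section game.
Variable R : realType.
Variables (f : Gstar R -> R -> R) (h : Gstarstar R -> R -> R -> R).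

Definition cost (G : graph) (v : G) (y : G -> R) : R :=
  f (class1 v) (y v) + \sum_(u \in nbrs v) h (class2 v u) (y v) (y u).

Definition actions (x : Gstar R -> R) (G : graph) : G -> R :=
  fun v => x (class1 v).

Definition quenched_nash (mu : probability (Gstar R) R) (x : Gstar R -> R) :=
  x \in Lfun mu 2%:E /\
  ae_rooted mu (fun G o => forall a : R,
    cost o (actions x (G:=G)) <= cost o [eta actions x (G:=G) with o |-> a]).

End game.

(* Main.v *)
(* The walk is reversible with respect to the degree, so the Green kernel is
   symmetric for it and the Schur test applies.  For a real l between rho and 1
   the function h(v) = sum_n l^-n p^(n)(v, o) is finite, positive and satisfies
   P h <= l h, hence K h = sum_n P^n h <= (1 - l)^-1 h, and K has norm at most
   (1 - l)^-1.  The function x = K xi solves x = xi + P x, which says that x_o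
   is the minimiser of the quadratic cost of the root. *)

Require Import Defs.
From HB Require Import structures.
From mathcomp Require Import all_boot all_order all_algebra.
From mathcomp Require Import all_classical all_reals all_analysis.
From mathcomp Require Import measurable_realfun.

Set Implicit Arguments.
Unset Strict Implicit.
Unset Printing Implicit Defensive.
Import Order.TTheory GRing.Theory Num.Theory.
Import numFieldNormedType.Exports.

Local Open Scope classical_set_scope.
Local Open Scope ring_scope.

(** * Sums of nonnegative extended reals over arbitrary index types *)

Section esum_extra.
Variable R : realType.
Local Open Scope ereal_scope.

Lemma esumZl (T : choiceType) (A : set T) (r : R) (a : T -> \bar R) :
  (0 <= r)%R -> (forall t, 0 <= a t) ->
  \esum_(t in A) (r%:E * a t) = r%:E * \esum_(t in A) a t.
Proof.
move=> r0 a0; rewrite /esum -ereal_supZl//; last first.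
  by apply/set0P; exists 0; exists set0; [exact: fsets_set0|rewrite fsbig_set0].
rewrite image_comp; congr ereal_sup.
by apply: eq_imagel => B _ /=; rewrite ge0_mule_fsumr.
Qed.

Lemma esumZr (T : choiceType) (A : set T) (r : R) (a : T -> \bar R) :
  (0 <= r)%R -> (forall t, 0 <= a t) ->
  \esum_(t in A) (a t * r%:E) = (\esum_(t in A) a t) * r%:E.
Proof.
move=> r0 a0; rewrite muleC -esumZl//.
by apply: eq_esum => t _; rewrite muleC.
Qed.

Lemma le_esum_term (T : choiceType) (s : T) (a : T -> \bar R) :
  (forall t, 0 <= a t) -> a s <= \esum_(t in setT) a t.
Proof.
move=> a0; rewrite -[leLHS](@esum_set1 _ _ s a)//.
by apply: ereal_sup_le => _ [X [fX _] <-]; exists X.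
Qed.

(** Tonelli: both sides are sums over a product, and swapping coordinates is a bijection between the
    two products. *)
Lemma exchange_esum (S T : choiceType) (a : S -> T -> \bar R) :
  (forall s t, 0 <= a s t) ->
  \esum_(s in setT) \esum_(t in setT) a s t =
  \esum_(t in setT) \esum_(s in setT) a s t.
Proof.
move=> a0; rewrite !esum_esum//.
rewrite (@reindex_esum _ _ _ (setT `*`` (fun=> setT)) (setT `*`` (fun=> setT))
  (fun z : T * S => (z.2, z.1)))//.
split=> //; first by move=> [x y] [x' y'] _ _ /= [-> ->].
by move=> [x y] _; exists (y, x).
Qed.

Lemma esum_finite_support (T : choiceType) (A : set T) (a : T -> \bar R) :
  finite_set A -> (forall t, 0 <= a t) -> (forall t, ~ A t -> a t = 0) ->
  \esum_(t in setT) a t = \sum_(t \in A) a t.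
Proof.
move=> fA a0 aA; rewrite -esum_fset// [RHS]esum_mkcond; apply: eq_esum => t _.
by case: ifPn => //; rewrite notin_setE => /aA.
Qed.

Lemma esum_diracZ (T : choiceType) (s : T) (a : T -> R) :
  (forall t, 0 <= a t)%R ->
  \esum_(t in setT) ((s == t)%:R * a t)%:E = (a s)%:E.
Proof.
move=> a0; rewrite (@esum_finite_support _ [set s])//.
- by rewrite fsbig_set1 eqxx mul1r.
- by move=> t; rewrite lee_fin mulr_ge0.
- by move=> t; case: eqVneq => [->|]; rewrite ?mul0r//= => _ [].
Qed.

Lemma esum_nat_recl (a : nat -> \bar R) : (forall n, 0 <= a n) ->
  \esum_(n in setT) a n = a 0%N + \esum_(n in setT) a n.+1.
Proof.
move=> a0; rewrite -!nneseries_esumT// nneseries_recl// -nneseries_addn//.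
by congr (_ + _); apply: eq_eseriesr => n _; rewrite addn1.
Qed.

Lemma esum_geometric (c r : R) : (0 <= c)%R -> (0 <= r < 1)%R ->
  \esum_(n in setT) (c * r ^+ n)%:E = (c / (1 - r))%:E.
Proof.
move=> c0 /andP[r0 r1]; rewrite -nneseries_esumT; last first.
  by move=> n; rewrite lee_fin mulr_ge0 ?exprn_ge0.
apply/cvg_lim => //.
under eq_fun do rewrite sumEFin.
apply/cvg_EFin; first exact: nearW.
by apply: cvg_geometric_series; rewrite ger0_norm.
Qed.

End esum_extra.

(** * Cauchy-Schwarz and the Schur test for a reversible kernel *)

Section schur.
Variables (R : realType) (T : choiceType).

(* Summing AM-GM, 2 |x| <= c h + x^2 / (c h), and then taking c = S / A. *)
Lemma esum_cauchy_schwarz (k h x : T -> R) (A B : R) :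
  (forall t, 0 <= k t) -> (forall t, 0 < h t) -> 0 < A ->
  (\esum_(t in setT) (k t * h t)%:E <= A%:E)%E ->
  (\esum_(t in setT) (k t * (x t ^+ 2 / h t))%:E <= B%:E)%E ->
  exists2 S : R, (\esum_(t in setT) (k t * `|x t|)%:E = S%:E)%E &
    S ^+ 2 <= A * B.
Proof.
move=> k0 h0 A0 kA kB.
have le_am_gm (c : R) : 0 < c ->
    (2%:E * (\esum_(t in setT) (k t * `|x t|)%:E) <= (c * A + c^-1 * B)%:E)%E.
  move=> c0; have cV0 : 0 <= c^-1 by rewrite invr_ge0 ltW.
  have kh0 t : (0 <= (k t * h t)%:E)%E by rewrite lee_fin mulr_ge0// ltW.
  have kx0 t : (0 <= (k t * (x t ^+ 2 / h t))%:E)%E.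
    by rewrite lee_fin mulr_ge0// divr_ge0 ?sqr_ge0// ltW.
  rewrite -esumZl//; last by move=> t; rewrite lee_fin mulr_ge0.
  apply: (@le_trans _ _ (\esum_(t in setT) (c%:E * (k t * h t)%:E +
      (c^-1)%:E * (k t * (x t ^+ 2 / h t))%:E))%E); last first.
    rewrite esumD//.
    - rewrite EFinD !EFinM !esumZl//; last by rewrite ltW.
      by apply: leeD; apply: lee_wpmul2l; rewrite ?lee_fin// ltW.
    - by move=> t _; apply: mule_ge0 => //; rewrite lee_fin ltW.
    - by move=> t _; apply: mule_ge0.
  apply: le_esum => t _; rewrite -!EFinM -EFinD lee_fin.
  rewrite mulrCA [c * _]mulrCA [c^-1 * _]mulrCA -mulrDr ler_wpM2l//.
  have ch0 : 0 < c * h t by rewrite mulr_gt0.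
  rewrite -(ler_pM2r ch0) mulrDl.
  have -> : c^-1 * (x t ^+ 2 / h t) * (c * h t) = `|x t| ^+ 2.
    by rewrite real_normK ?num_real// mulrACA mulVf ?mul1r ?divfK ?gt_eqF.
  rewrite -subr_ge0 (_ : _ - _ = (c * h t - `|x t|) ^+ 2) ?sqr_ge0//.
  by rewrite sqrrB -expr2 addrAC -mulrA mulr_natl [`|_| * _]mulrC.
have S0 : (0 <= \esum_(t in setT) (k t * `|x t|)%:E)%E.
  by apply: esum_ge0 => t _; rewrite lee_fin mulr_ge0.
have B0 : 0 <= B.
  rewrite -lee_fin; apply: le_trans kB; apply: esum_ge0 => t _.
  by rewrite lee_fin mulr_ge0// divr_ge0 ?sqr_ge0// ltW.
case SE : (\esum_(t in setT) (k t * `|x t|)%:E)%E => [S| |].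
- exists S => //; move: S0 le_am_gm; rewrite SE lee_fin le_eqVlt.
  (* The choice [c = S / A] needs [S > 0]; for [S = 0] the bound is just [0 <= A * B]. *)
  move=> /orP[/eqP<- _|S0 /(_ (S / A))].
    by rewrite expr0n mulr_ge0// ltW.
  rewrite divr_gt0// divfK ?gt_eqF// -EFinM lee_fin => /(_ isT).
  rewrite mulr_natl mulr2n lerD2l invf_div.
  by rewrite mulrAC ler_pdivlMr.
(* Any one value of [c] already bounds the sum by a real number. *)
- move: (le_am_gm 1 ltr01); rewrite SE gt0_muley; first by rewrite leye_eq.
  by rewrite lte_fin.
- by move: S0; rewrite SE.
Qed.

(** Cauchy-Schwarz in row [v], with test function [h], gives [S v ^+ 2 <= C * h v * B v], where
    [B v] sums [k v u * xi u ^+ 2 / h u]. Weighting by [m v], summing over [v] and exchanging the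
    sums costs a second factor [C]. *)
Lemma schur_test (k : T -> T -> R) (m h xi : T -> R) (C : R) :
  (forall v u, 0 <= k v u) -> (forall v, 0 < m v) -> (forall v, 0 < h v) ->
  0 < C -> (forall v u, m v * k v u = m u * k u v) ->
  (forall v, \esum_(u in setT) (k v u * h u)%:E <= (C * h v)%:E)%E ->
  (\esum_(v in setT) (m v * xi v ^+ 2)%:E < +oo)%E ->
  exists2 S : T -> R,
    forall v, (\esum_(u in setT) (k v u * `|xi u|)%:E = (S v)%:E)%E &
    (\esum_(v in setT) (m v * S v ^+ 2)%:E <=
      (C ^+ 2)%:E * (\esum_(v in setT) (m v * xi v ^+ 2)%:E))%E.
Proof.
move=> k0 m0 h0 C0 km kh xioo.
have kx0 v u : (0 <= (k v u * (xi u ^+ 2 / h u))%:E)%E.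
  by rewrite lee_fin mulr_ge0// divr_ge0 ?sqr_ge0// ltW.
have mh0 v : 0 < m v * h v by rewrite mulr_gt0.
pose B v := (\esum_(u in setT) (k v u * (xi u ^+ 2 / h u))%:E)%E.
have B0 v : (0 <= B v)%E by apply: esum_ge0.
have mB0 v : (0 <= (m v * h v)%:E * B v)%E.
  by rewrite mule_ge0// lee_fin ltW.
have mx0 v : (0 <= (m v * xi v ^+ 2)%:E)%E.
  by rewrite lee_fin mulr_ge0 ?sqr_ge0// ltW.
(* Reversibility turns the column sum of [m v * h v * k v u] over [v] into [m u] times the row sum
   of [k u v * h v], so the one bound [kh] serves for rows and columns. *)
have le_B : (\esum_(v in setT) ((m v * h v)%:E * B v) <=
    C%:E * \esum_(v in setT) (m v * xi v ^+ 2)%:E)%E.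
  under eq_esum => v _ do rewrite -esumZl ?(ltW (mh0 v))//.
  rewrite exchange_esum; last by move=> v u; rewrite mule_ge0// lee_fin ltW.
  rewrite -esumZl ?(ltW C0)//; apply: le_esum => u _.
  have x0 : 0 <= m u * (xi u ^+ 2 / h u).
    by rewrite mulr_ge0 ?divr_ge0 ?sqr_ge0// ltW.
  rewrite (_ : (C%:E * _)%E = ((m u * (xi u ^+ 2 / h u))%:E * (C * h u)%:E)%E).
    apply: le_trans (lee_wpmul2l _ (kh u)); last by rewrite lee_fin.
    rewrite -esumZl//; last by move=> v; rewrite lee_fin mulr_ge0// ltW.
    apply: le_esum => v _; rewrite -!EFinM lee_fin.
    by rewrite mulrACA km [leRHS]mulrACA [h v * _]mulrC.
  rewrite -!EFinM; congr EFin.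
  rewrite [C * h u]mulrC [RHS]mulrA.
  by rewrite -[X in _ = X * C]mulrA divfK ?gt_eqF// mulrC.
(* Since [m v * h v > 0], a single infinite [B v] would make the sum in [le_B] infinite. *)
have Bfin v : (B v < +oo)%E.
  rewrite ltey; apply/eqP => Boo.
  have : (\esum_(v in setT) ((m v * h v)%:E * B v) < +oo)%E.
    by apply: le_lt_trans le_B _; rewrite lte_mul_pinfty// lee_fin ltW.
  rewrite ltNge => /negP; apply; apply: le_trans (le_esum_term v mB0).
  by rewrite Boo gt0_muley// lte_fin.
have BE v : (B v = (fine (B v))%:E)%E by rewrite fineK// ge0_fin_numE.
have /choice[S SP] v : exists S : R,
    (\esum_(u in setT) (k v u * `|xi u|)%:E = S%:E)%E /\
    S ^+ 2 <= C * h v * fine (B v).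
  have [|||S SE SB] :=
    @esum_cauchy_schwarz (k v) h xi (C * h v) (fine (B v)) (k0 v) h0.
  - by rewrite mulr_gt0.
  - exact: kh.
  - by rewrite -BE.
  - by exists S.
exists S => [v|]; first by have [] := SP v.
apply: (@le_trans _ _
    (C%:E * \esum_(v in setT) ((m v * h v)%:E * B v))%E).
  rewrite -esumZl ?(ltW C0)//; apply: le_esum => v _.
  rewrite BE -!EFinM lee_fin.
  rewrite -[X in C * X]mulrA [leRHS]mulrCA ler_wpM2l ?(ltW (m0 _))// mulrA.
  by have [] := SP v.
by rewrite expr2 EFinM -muleA; apply: lee_wpmul2l; rewrite ?lee_fin ?(ltW C0).
Qed.

End schur.

(** * Linearity of sums of summable real families *)

Section vsum.
Variables (R : realType) (G : graph).
Implicit Types F H p q : G -> R.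

(** The form that [green_op] takes once the Green kernel is known to be real-valued. *)
Definition rsum F : R := fine (vsum (fun u => (F u)%:E)).

Definition rsummable F : Prop := summable [set: G] (fun u => (F u)%:E).

Lemma rsummableE F (S : R) :
  (\esum_(u in [set: G]) `|F u|%:E)%E = S%:E -> rsummable F.
Proof.
rewrite /rsummable /summable => FS.
by rewrite (@eq_esum _ _ _ _ (fun u => `|F u|%:E)) ?FS ?ltry.
Qed.

(** [vsum] uses the positive and negative parts, but any splitting into nonnegative summable
    functions yields the same value. Linearity thus reduces to that of nonnegative sums. *)
Lemma rsumB p q (P Q : R) : (forall u, 0 <= p u) -> (forall u, 0 <= q u) ->
  (\esum_(u in [set: G]) (p u)%:E)%E = P%:E ->
  (\esum_(u in [set: G]) (q u)%:E)%E = Q%:E ->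
  rsum (fun u => p u - q u) = P - Q.
Proof.
move=> p0 q0 pP qQ.
have summ (f : G -> R) (S : R) : (forall u, 0 <= f u) ->
    (\esum_(u in [set: G]) (f u)%:E)%E = S%:E -> rsummable f.
  move=> f0 fS; apply: (@rsummableE _ S); rewrite -fS.
  by apply: eq_esum => u _; rewrite ger0_norm.
rewrite /rsum /vsum; have := esumB (summ _ _ p0 pP) (summ _ _ q0 qQ).
move=> /(_ (fun u _ => p0 u) (fun u _ => q0 u)).
by rewrite pP qQ => ->.
Qed.

(* F = |F| - (|F| - F); the terms of the second sum are at most 2 |F|. *)
Lemma rsummableP F : rsummable F ->
  exists p q (P Q : R), [/\ (forall u, 0 <= p u) /\ (forall u, 0 <= q u),
    F = (fun u => p u - q u), (\esum_(u in [set: G]) `|F u|%:E)%E = P%:E,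
    (\esum_(u in [set: G]) (p u)%:E)%E = P%:E &
    (\esum_(u in [set: G]) (q u)%:E)%E = Q%:E /\ 0 <= Q <= P + P].
Proof.
move=> sF; have q0 u : 0 <= `|F u| - F u by rewrite subr_ge0 ler_norm.
move: sF; rewrite /rsummable summableE => /fineK; set P := fine _ => PE.
have qP : (\esum_(u in [set: G]) (`|F u| - F u)%:E <= (P + P)%:E)%E.
  rewrite EFinD PE -esumD//; apply: le_esum => u _.
  by rewrite -EFinD lee_fin lerD2l -normrN ler_norm.
have Q0 : (0 <= \esum_(u in [set: G]) (`|F u| - F u)%:E)%E.
  by apply: esum_ge0 => u _; rewrite lee_fin.
have /fineK QE : (\esum_(u in [set: G]) (`|F u| - F u)%:E)%E \is a fin_num.
  by rewrite ge0_fin_numE// (le_lt_trans qP)// ltry.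
exists (fun u => `|F u|), (fun u => `|F u| - F u), P, (fine
  (\esum_(u in [set: G]) (`|F u| - F u)%:E)%E); split=> //.
- by apply/funext => u; rewrite subKr.
- by rewrite -QE in Q0 qP; rewrite -lee_fin Q0 -lee_fin.
Qed.

(** The sum is [P - Q] with [P] the sum of the absolute values and [0 <= Q <= P + P], hence it lies
    between [- P] and [P]. *)
Lemma ler_norm_rsum F (S : R) :
  (\esum_(u in [set: G]) `|F u|%:E)%E = S%:E -> `|rsum F| <= S.
Proof.
move=> FS; have [p [q [P [Q [[p0 q0] Fpq]]]]] := rsummableP (rsummableE FS).
rewrite {1}FS => -[<-] pE [qE /andP[Q0 QP]].
rewrite Fpq (rsumB p0 q0 pE qE) ler_norml lerBlDr lerDl Q0 andbT.
by rewrite lerBrDl -lerBrDr opprK.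
Qed.

Lemma rsumD F H : rsummable F -> rsummable H ->
  rsum (fun u => F u + H u) = rsum F + rsum H.
Proof.
move=> /rsummableP[p [q [P [Q [[p0 q0] -> _ pP [qQ _]]]]]].
move=> /rsummableP[r [s [V [W [[r0 s0] -> _ rV [sW _]]]]]].
rewrite (rsumB p0 q0 pP qQ) (rsumB r0 s0 rV sW) addrACA -opprD.
rewrite -(@rsumB (fun u => p u + r u) (fun u => q u + s u)).
- by congr rsum; apply/funext => u; rewrite addrACA -opprD.
- by move=> u; rewrite addr_ge0.
- by move=> u; rewrite addr_ge0.
- by rewrite EFinD -pP -rV -esumD// => u _; rewrite lee_fin.
- by rewrite EFinD -qQ -sW -esumD// => u _; rewrite lee_fin.
Qed.

Lemma rsumN F : rsummable F -> rsum (fun u => - F u) = - rsum F.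
Proof.
move=> /rsummableP[p [q [P [Q [[p0 q0] -> _ pP [qQ _]]]]]].
rewrite (rsumB p0 q0 pP qQ) opprB -(rsumB q0 p0 qQ pP).
by congr rsum; apply/funext => u; rewrite opprB.
Qed.

Lemma rsumZ (a : R) F : rsummable F ->
  rsum (fun u => a * F u) = a * rsum F.
Proof.
wlog a0 : a F / 0 <= a => [pos sF|].
  have [/pos->//|a0] := leP 0 a.
  rewrite (_ : (fun u => _) = fun u => - a * - F u); last first.
    by apply/funext => u; rewrite mulrNN.
  have sN : rsummable (fun u => - F u).
    by move: sF; rewrite {1}/rsummable summableN.
  by rewrite pos ?rsumN ?mulrNN// oppr_ge0 ltW.
move=> /rsummableP[p [q [P [Q [[p0 q0] -> _ pP [qQ _]]]]]].
rewrite (rsumB p0 q0 pP qQ) mulrBr.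
rewrite -(@rsumB (fun u => a * p u) (fun u => a * q u)).
- by congr rsum; apply/funext => u; rewrite mulrBr.
- by move=> u; rewrite mulr_ge0.
- by move=> u; rewrite mulr_ge0.
- by rewrite EFinM -pP -esumZl.
- by rewrite EFinM -qQ -esumZl.
Qed.

Lemma rsummableZ (a : R) F : rsummable F -> rsummable (fun u => a * F u).
Proof.
move=> /rsummableP[_ [_ [P [_ [_ _ FP _ _]]]]].
apply: (@rsummableE _ (`|a| * P)); rewrite EFinM -FP -esumZl//.
by apply: eq_esum => u _; rewrite normrM.
Qed.

Lemma rsummableD F H :
  rsummable F -> rsummable H -> rsummable (fun u => F u + H u).
Proof. exact: summableD. Qed.

Lemma rsum0 : rsum (fun=> 0) = 0.
Proof.
have := @rsumB (fun=> 0) (fun=> 0) 0 0; rewrite /= subr0.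
by apply=> //; rewrite esum1.
Qed.

Lemma rsummable0 : rsummable (fun=> 0).
Proof. by apply: (@rsummableE _ 0); rewrite esum1// => u _; rewrite normr0. Qed.

(** Serves to exchange the finite average over neighbours with the sum that defines the Green
    operator. *)
Lemma rsum_sum (I : Type) (s : seq I) (c : I -> R) (F : I -> G -> R) :
  (forall i, rsummable (F i)) ->
  rsummable (fun u => \sum_(i <- s) c i * F i u) /\
  rsum (fun u => \sum_(i <- s) c i * F i u) = \sum_(i <- s) c i * rsum (F i).
Proof.
move=> sF; elim: s => [|i s [IHs IH]].
  rewrite big_nil; under eq_fun do rewrite big_nil.
  by split; [exact: rsummable0|exact: rsum0].
under eq_fun do rewrite big_cons.
have sci := rsummableZ (c i) (sF i).
by rewrite big_cons rsumD// rsumZ// IH; split=> //; exact: rsummableD.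
Qed.

Lemma rsum_dirac (v : G) F :
  rsummable (fun u => (v == u)%:R * F u) /\
  rsum (fun u => (v == u)%:R * F u) = F v.
Proof.
split.
  apply: (@rsummableE _ `|F v|).
  rewrite -(@esum_diracZ _ _ v (fun u => `|F u|))//.
  by apply: eq_esum => u _; rewrite normrM [`|_%:R|]ger0_norm.
rewrite -[RHS](@subKr _ `|F v|) -(@rsumB (fun u => (v == u)%:R * `|F u|)
  (fun u => (v == u)%:R * (`|F u| - F u))).
- by congr rsum; apply/funext => u; rewrite -mulrBr subKr.
- by move=> u; rewrite mulr_ge0.
- by move=> u; rewrite mulr_ge0// subr_ge0 ler_norm.
- exact: (@esum_diracZ _ _ v (fun u => `|F u|)).
- by apply: (@esum_diracZ _ _ v) => u; rewrite subr_ge0 ler_norm.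
Qed.

End vsum.

(** * Transition probabilities, reversibility and the Green kernel *)

Section walk.
Variables (R : realType) (G : graph).
Implicit Types u v w : G.

Local Notation step := (@step R G).
Local Notation nstep := (@nstep R G).
Local Notation green := (@green R G).

Lemma finite_nbrs v : finite_set (nbrs v).
Proof. exact: adj_finite. Qed.

Lemma deg_gt0 v w : adj v w -> (0 < deg v)%N.
Proof.
move=> vw; rewrite /deg finmap.cardfs_gt0; apply/finmap.fset0Pn; exists w.
by rewrite in_fset_set ?inE//; exact: finite_nbrs.
Qed.

(** An edge at [v] makes [deg v] positive; without an edge both sides vanish. The symmetry of the
    right-hand side is the source of reversibility. *)
Lemma deg_step v w : (deg v)%:R * step v w = (adj v w)%:R.
Proof.
rewrite /step; case: ifPn => [vw|_]; last by rewrite mulr0.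
by rewrite divff// pnatr_eq0 -lt0n (deg_gt0 vw).
Qed.

Lemma step_ge0 v w : 0 <= step v w.
Proof. by rewrite /step; case: ifP => // _; rewrite invr_ge0. Qed.

Lemma step_gt0 v w : adj v w -> 0 < step v w.
Proof. by move=> vw; rewrite /step vw invr_gt0 ltr0n (deg_gt0 vw). Qed.

Lemma nstep_ge0 n v u : 0 <= nstep n v u.
Proof.
elim: n v => [|n IHn] v //=.
by apply: fsumr_ge0 => w _; rewrite mulr_ge0// step_ge0.
Qed.

(** The sum over all vertices in [nstep] is supported on the finite set of neighbours, so it is a
    true sum and not the default value for infinite support. *)
Lemma fsum_step v (F : G -> R) :
  \sum_(w \in [set: G]) step v w * F w = \sum_(w \in nbrs v) step v w * F w.
Proof.
apply/esym/fsbig_widen => // w [_ vw] /=.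
by rewrite /step; case: ifP => [/vw//|_]; rewrite mul0r.
Qed.

Lemma esum_step v (F : G -> \bar R) : (forall w, (0 <= F w)%E) ->
  (\esum_(w in [set: G]) ((step v w)%:E * F w) =
   \sum_(w \in nbrs v) ((step v w)%:E * F w))%E.
Proof.
move=> F0; apply: esum_finite_support.
- exact: finite_nbrs.
- by move=> w; rewrite mule_ge0// lee_fin step_ge0.
- by move=> w vw; rewrite /step; case: ifP => [/vw//|_]; rewrite mul0e.
Qed.

Lemma nstepS n v u :
  (nstep n.+1 v u)%:E = \esum_(w in [set: G]) (step v w * nstep n w u)%:E.
Proof.
under eq_esum do rewrite EFinM.
rewrite /= fsum_step esum_step; last by move=> w; rewrite lee_fin nstep_ge0.
by rewrite -fsumEFin//; exact: finite_nbrs.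
Qed.

(** [nstep] splits off the first step; this splits off the last one, which is what the first step
    becomes when paths are reversed. *)
Lemma nstepSr n v u :
  (nstep n.+1 v u)%:E = \esum_(w in [set: G]) (nstep n v w * step w u)%:E.
Proof.
elim: n v => [|n IHn] v.
  rewrite nstepS /= esum_diracZ; last by move=> w; exact: step_ge0.
  rewrite -[RHS](esum_diracZ u (step_ge0 v)).
  by apply: eq_esum => w _; rewrite mulrC eq_sym.
rewrite nstepS; under eq_esum => w _.
  rewrite EFinM IHn -esumZl ?step_ge0//; last first.
    by move=> z; rewrite lee_fin mulr_ge0 ?nstep_ge0 ?step_ge0.
  over.
rewrite exchange_esum; last first.
  by move=> w z; rewrite -EFinM lee_fin !mulr_ge0 ?nstep_ge0 ?step_ge0.
apply: eq_esum => z _; rewrite EFinM nstepS -esumZr ?step_ge0//; last first.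
  by move=> w; rewrite lee_fin mulr_ge0 ?nstep_ge0 ?step_ge0.
by apply: eq_esum => w _; rewrite -!EFinM mulrA.
Qed.

(** Expand the left side at its first step and the right side at its last. By [deg_step] and
    induction both summands become an adjacency entry times [nstep n w u]. *)
Lemma nstep_reversible n v u :
  (deg v)%:R * nstep n v u = (deg u)%:R * nstep n u v.
Proof.
elim: n v => [|n IHn] v /=.
  by rewrite eq_sym; case: eqVneq => [->//|]; rewrite !mulr0.
suff : ((deg v)%:R%:E * (nstep n.+1 v u)%:E =
        (deg u)%:R%:E * (nstep n.+1 u v)%:E)%E by rewrite -!EFinM => -[].
rewrite nstepS nstepSr -!esumZl//; first last.
- by move=> w; rewrite lee_fin mulr_ge0 ?nstep_ge0 ?step_ge0.
- by move=> w; rewrite lee_fin mulr_ge0 ?nstep_ge0 ?step_ge0.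
apply: eq_esum => w _; rewrite -!EFinM !mulrA deg_step -IHn mulrAC deg_step.
by rewrite adj_sym.
Qed.

Lemma greenE v u : green v u = \esum_(n in setT) (nstep n v u)%:E.
Proof. by apply: nneseries_esumT => n; rewrite lee_fin nstep_ge0. Qed.

Lemma green_ge0 v u : (0 <= green v u)%E.
Proof.
by rewrite greenE; apply: esum_ge0 => n _; rewrite lee_fin nstep_ge0.
Qed.

(** [K = I + P K]: time 0 contributes the identity and the later times a shifted series. It holds in
    the extended reals, before [K] is known to be finite. *)
Lemma green_rec v u : green v u =
  ((v == u)%:R%:E + \sum_(w \in nbrs v) ((step v w)%:E * green w u))%E.
Proof.
rewrite greenE esum_nat_recl; last by move=> n; rewrite lee_fin nstep_ge0.
congr (_ + _)%E; rewrite -esum_step; last by move=> w; exact: green_ge0.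
under eq_esum do rewrite nstepS.
rewrite exchange_esum; last first.
  by move=> n w; rewrite lee_fin mulr_ge0 ?step_ge0 ?nstep_ge0.
apply: eq_esum => w _; rewrite greenE -esumZl ?step_ge0// => n.
by rewrite lee_fin nstep_ge0.
Qed.

End walk.

(** The root test: some tail has supremum [l < 1], any [s] strictly between [l] and 1 dominates it
    geometrically, and a constant absorbs the finitely many other terms. *)
Lemma limn_esup_root_lt1 (R : realType) (a : nat -> R) :
  (forall n, 0 <= a n) ->
  (limn_esup (fun n => (a n `^ n%:R^-1)%:E) < 1)%E ->
  exists M s : R, [/\ 0 <= M, 0 < s < 1 & forall n, a n <= M * s ^+ n].
Proof.
move=> a0 /ereal_inf_ltP[_ [V [N _ NV] <-]].
set l := ereal_sup _ => l1.
have al n : (N <= n)%N -> ((a n `^ n%:R^-1)%:E <= l)%E.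
  by move=> Nn; apply: ereal_sup_ubound; exists n => //; exact: NV.
have l0 : (0 <= l)%E.
  by apply: le_trans (al N (leqnn N)); rewrite lee_fin powR_ge0.
move: l l0 l1 al => [l| |]//; rewrite lee_fin lte_fin => l0 l1 al.
pose s := (l + 1) / 2.
have [ls s1] : l < s /\ s < 1 by have := midf_lt l1; rewrite /s => -[].
have s0 : 0 < s by exact: le_lt_trans ls.
have sn0 n : 0 < s ^+ n by rewrite exprn_gt0.
have as0 n : 0 <= a n / s ^+ n by rewrite divr_ge0// ltW.
pose M := 1 + \sum_(i < N.+1) a i / s ^+ i.
have M1 : 1 <= M by rewrite lerDl sumr_ge0.
exists M, s; split; [exact: le_trans M1|by rewrite s0|move=> n].
(* Splitting at [N.+1] and not at [N] keeps [n = 0] out of the tail, where the [n]-th root has to be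
   undone. *)
have [nN|Nn] := ltnP n N.+1.
  rewrite -ler_pdivrMr// /M (bigD1 (Ordinal nN))//= addrCA lerDl.
  by rewrite addr_ge0// sumr_ge0.
have n0 : n%:R != 0 :> R by rewrite pnatr_eq0; case: n Nn.
have -> : a n = (a n `^ n%:R^-1) ^+ n.
  by rewrite -powR_mulrn ?powR_ge0// -powRrM mulVf// powRr1.
apply: (@le_trans _ _ (s ^+ n)); last by rewrite ler_peMl// ltW.
apply: lerXn2r; rewrite ?nnegrE ?powR_ge0 ?(ltW s0)//.
by apply: le_trans (ltW ls); rewrite -lee_fin al// ltnW.
Qed.

(** Connectedness as an induction principle; it spreads finiteness, positivity and nonzero degree
    from the root. *)
Lemma adj_ind (G : graph) (P : G -> Prop) (o : G) :
  P o -> (forall v w, adj v w -> P v -> P w) -> forall v, P v.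
Proof.
move=> Po PS v; have [p] := adj_connected o v.
elim: p o Po => [|w p IHp] o Po /=; first by move=> _ <-.
by move=> /andP[ow] wp pv; apply: IHp wp pv; exact: PS ow Po.
Qed.

(** * A positive superharmonic function and finiteness of the Green kernel *)

Section superharmonic.
Variables (R : realType) (G : graph) (o : G).
Implicit Types u v w : G.

Local Notation step := (@step R G).
Local Notation nstep := (@nstep R G).
Local Notation green := (@green R G).

(** Applying [P] to the series [H] shifts its index by one, which gives [l] times [H] without the
    term [n = 0]; hence [P H <= l H]. *)
Lemma exists_superharmonic : (rho R o o < 1)%E ->
  exists (h : G -> R) (l : R), [/\ 0 < l < 1, forall v, 0 < h v &
    forall v, (\esum_(w in [set: G]) (step v w * h w)%:E <= (l * h v)%:E)%E].
Proof.
move=> /limn_esup_root_lt1[n|M [s [M0 /andP[s0 s1] Ms]]].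
  exact: nstep_ge0.
(* [s < l] makes the series at [o] geometric with ratio [s / l < 1]; [l < 1] is kept for summing the
   powers of [P]. *)
have [l /andP[sl l1]] : exists l, s < l < 1.
  by exists ((s + 1) / 2); apply/andP; have := midf_lt s1; case.
have l0 : 0 < l by exact: lt_trans sl.
pose H v : \bar R := (\esum_(n in setT) (l ^- n * nstep n v o)%:E)%E.
have ln0 n v : (0 <= (l ^- n * nstep n v o)%:E)%E.
  by rewrite lee_fin mulr_ge0 ?nstep_ge0// invr_ge0 exprn_ge0// ltW.
have H0 v : (0 <= H v)%E by exact: esum_ge0.
have HS v : (\esum_(w in [set: G]) ((step v w)%:E * H w) <= l%:E * H v)%E.
  under eq_esum => w _ do rewrite -esumZl ?step_ge0//.
  rewrite exchange_esum; last first.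
    by move=> w n; rewrite mule_ge0// lee_fin step_ge0.
  rewrite [leRHS](_ : _ = l%:E * (l ^- 0 * nstep 0 v o)%:E +
      \esum_(n in setT) (l%:E * (l ^- n.+1 * nstep n.+1 v o)%:E))%E; last first.
    rewrite esumZl ?(ltW l0)// -ge0_muleDr ?esum_ge0//.
    by rewrite -(@esum_nat_recl _ (fun n => (l ^- n * nstep n v o)%:E)).
  apply: le_trans (leeDr _ _); last by rewrite mule_ge0// lee_fin ltW.
  apply: le_esum => n _; rewrite [in leRHS]EFinM nstepS muleA -EFinM.
  rewrite exprS invfM mulrA divff ?gt_eqF// mul1r -esumZl//; first last.
  - by move=> w; rewrite lee_fin mulr_ge0 ?step_ge0 ?nstep_ge0.
  - by rewrite invr_ge0 exprn_ge0// ltW.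
  by apply: le_esum => w _; rewrite -!EFinM lee_fin mulrCA.
(* A Harnack inequality across an edge. Convergence is known only at [o]; this carries finiteness
   from [v] to [w] and, read in reverse, positivity. *)
have Hadj v w : ((step v w)%:E * H w <= l%:E * H v)%E.
  apply: le_trans (HS v).
  apply: (@le_esum_term _ _ w (fun w => _ * H w)%E) => z.
  by rewrite mule_ge0// lee_fin step_ge0.
have Hoo v : (H v < +oo)%E.
  apply: (@adj_ind _ (fun v => H v < +oo)%E o) => [|{}v w vw vfin].
    apply: (@le_lt_trans _ _ (\esum_(n in setT) (M * (s / l) ^+ n)%:E)%E).
      apply: le_esum => n _; rewrite lee_fin expr_div_n mulrA mulrC.
      by rewrite ler_wpM2r// invr_ge0 exprn_ge0// ltW.
    rewrite esum_geometric ?ltry//.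
    by rewrite divr_ge0 ?(ltW s0) ?(ltW l0)// ltr_pdivrMr// mul1r.
  rewrite ltey; apply/eqP => woo; have := Hadj v w.
  rewrite woo gt0_muley ?lte_fin ?step_gt0// leNgt lte_mul_pinfty//.
  - by rewrite lee_fin ltW.
have Hpos v : (0 < H v)%E.
  apply: (@adj_ind _ (fun v => 0 < H v)%E o) => [|{}v w vw vpos].
    apply: (@lt_le_trans _ _ (l ^- 0 * nstep 0 o o)%:E).
      by rewrite lte_fin /= eqxx expr0 invr1 mulr1.
    exact: (@le_esum_term _ _ 0%N (fun n => (l ^- n * nstep n o o)%:E)).
  have : (0 < l%:E * H w)%E.
    apply: lt_le_trans (Hadj w v).
    by rewrite mule_gt0// lte_fin step_gt0// adj_sym.
  by rewrite pmule_rgt0 ?lte_fin.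
have HE v : (H v = (fine (H v))%:E) by rewrite fineK// ge0_fin_numE.
exists (fine \o H), l; split; first by rewrite l0.
  by move=> v; rewrite -lte_fin -HE.
move=> v; rewrite EFinM -HE; apply: le_trans (HS v).
by apply: le_esum => w _; rewrite [in leRHS]HE.
Qed.

(** Iterating [P h <= l h] bounds [P^n h] by [l^n h], and the geometric series gives
    [C = (1 - l)^-1]. As [h > 0], this also forces every entry of the Green kernel to be finite. *)
Lemma green_superharmonic : (rho R o o < 1)%E ->
  exists (k : G -> G -> R) (h : G -> R) (C : R),
    [/\ (forall v u, 0 <= k v u) /\ (forall v u, green v u = (k v u)%:E),
      forall v, 0 < h v, 0 < C &
      forall v, (\esum_(u in [set: G]) (k v u * h u)%:E <= (C * h v)%:E)%E].
Proof.
move=> /exists_superharmonic[h [l [/andP[l0 l1] h0 hl]]].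
have nh0 n v u : (0 <= (nstep n v u * h u)%:E)%E.
  by rewrite lee_fin mulr_ge0 ?nstep_ge0// ltW.
have nstep_h n v :
    (\esum_(u in [set: G]) (nstep n v u * h u)%:E <= (h v * l ^+ n)%:E)%E.
  elim: n v => [|n IHn] v.
    by rewrite esum_diracZ ?mulr1// => u; rewrite ltW.
  rewrite (_ : (\esum_(u in _) _)%E = (\esum_(w in [set: G]) ((step v w)%:E *
      \esum_(u in [set: G]) (nstep n w u * h u)%:E))%E); last first.
    under [RHS]eq_esum => w _ do rewrite -esumZl ?step_ge0//.
    rewrite exchange_esum; last first.
      by move=> w u; rewrite mule_ge0// lee_fin step_ge0.
    apply: eq_esum => u _; rewrite EFinM nstepS -esumZr ?(ltW (h0 u))//.
      by apply: eq_esum => w _; rewrite -!EFinM mulrA.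
    by move=> w; rewrite lee_fin mulr_ge0 ?step_ge0 ?nstep_ge0.
  apply: (@le_trans _ _
      (\esum_(w in [set: G]) ((step v w * h w)%:E * (l ^+ n)%:E))%E).
    apply: le_esum => w _; rewrite -EFinM -mulrA EFinM.
    by apply: lee_wpmul2l; rewrite ?lee_fin ?step_ge0.
  rewrite esumZr ?exprn_ge0 ?(ltW l0)//; last first.
    by move=> w; rewrite lee_fin mulr_ge0 ?step_ge0// ltW.
  apply: le_trans (lee_wpmul2r _ (hl v)) _.
    by rewrite lee_fin exprn_ge0// ltW.
  by rewrite -EFinM lee_fin exprS [l * h v]mulrC mulrA.
have green_h v : (\esum_(u in [set: G]) (green v u * (h u)%:E) <=
    ((1 - l)^-1 * h v)%:E)%E.
  rewrite (_ : (\esum_(u in _) _)%E =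
      (\esum_(n in setT) \esum_(u in [set: G]) (nstep n v u * h u)%:E)%E).
    apply: le_trans (le_esum (fun n _ => nstep_h n v)) _.
    by rewrite esum_geometric ?(ltW (h0 v)) ?(ltW l0)// mulrC.
  rewrite -exchange_esum//; apply: eq_esum => u _.
  rewrite greenE -esumZr ?(ltW (h0 u))// => n.
  by rewrite lee_fin nstep_ge0.
have gh0 v u : (0 <= green v u * (h u)%:E)%E.
  by rewrite mule_ge0 ?green_ge0// lee_fin ltW.
have gE v u : green v u = (fine (green v u))%:E.
  rewrite fineK// ge0_fin_numE ?green_ge0// ltey; apply/eqP => goo.
  have := le_trans (le_esum_term u (gh0 v)) (green_h v).
  by rewrite goo gt0_mulye ?lte_fin// leye_eq.
exists (fun v u => fine (green v u)), h, (1 - l)^-1; split => //.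
- by split=> // v u; rewrite fine_ge0// green_ge0.
- by rewrite invr_gt0 subr_gt0.
- move=> v; apply: le_trans (green_h v); apply: le_esum => u _.
  by rewrite [in leRHS]gE.
Qed.

End superharmonic.

(** * Boundedness of the Green operator and its fixed-point equation *)

Section green_operator.
Variables (R : realType) (G : graph) (o : G).
Hypotheses (deg_o : (0 < deg o)%N) (rho_lt1 : (rho R o o < 1)%E).
Implicit Types (u v w : G) (xi : G -> R).

Local Notation step := (@step R G).
Local Notation green := (@green R G).

(** The hypothesis concerns the root alone; every other vertex is reached through an edge. *)
Lemma all_deg_gt0 v : (0 < deg v)%N.
Proof.
apply: (@adj_ind _ (fun v => 0 < deg v)%N o) => // {}v w vw _.
by apply: (@deg_gt0 _ w v); rewrite adj_sym.
Qed.

Lemma green_reversible v u :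
  ((deg v)%:R%:E * green v u = (deg u)%:R%:E * green u v)%E.
Proof.
rewrite !greenE -!esumZl//; try by move=> n; rewrite lee_fin nstep_ge0.
by apply: eq_esum => n _; rewrite -!EFinM nstep_reversible.
Qed.

Lemma in_l2E xi : in_l2 xi ->
  (\esum_(v in [set: G]) ((deg v)%:R * xi v ^+ 2)%:E)%E =
  (fine (\esum_(v in [set: G]) ((deg v)%:R * xi v ^+ 2)%:E)%E)%:E.
Proof.
move=> xil2; rewrite fineK// ge0_fin_numE//.
by apply: esum_ge0 => v _; rewrite lee_fin mulr_ge0 ?sqr_ge0.
Qed.

(** The Schur test with weight [deg], packaged so that the real kernel and its constant are chosen
    once. *)
Lemma green_kernel : exists (k : G -> G -> R) (C : R),
  [/\ 0 < C, forall v u, green v u = (k v u)%:E,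
    forall xi v, green_op xi v = rsum (fun u => k v u * xi u),
    forall xi, in_l2 xi -> forall v, rsummable (fun u => k v u * xi u) &
    forall xi, in_l2 xi ->
      (\esum_(v in [set: G]) ((deg v)%:R * green_op xi v ^+ 2)%:E <=
      (C ^+ 2)%:E * (\esum_(v in [set: G]) ((deg v)%:R * xi v ^+ 2)%:E))%E].
Proof.
have [k [h [C [[k0 gE] h0 C0 kh]]]] := green_superharmonic rho_lt1.
have opE xi v : green_op xi v = rsum (fun u => k v u * xi u).
  by congr (fine (vsum _)); apply/funext => u; rewrite gE.
have kS xi : in_l2 xi -> exists2 S : G -> R,
    forall v, (\esum_(u in [set: G]) `|k v u * xi u|%:E)%E = (S v)%:E &
    (\esum_(v in [set: G]) ((deg v)%:R * S v ^+ 2)%:E <=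
    (C ^+ 2)%:E * (\esum_(v in [set: G]) ((deg v)%:R * xi v ^+ 2)%:E))%E.
  move=> xil2.
  have [|v u||S SE SB] :=
      @schur_test R G k (fun v => (deg v)%:R) h xi C k0 _ h0 C0 _ kh.
  - by move=> v; rewrite ltr0n all_deg_gt0.
  - by apply: EFin_inj; rewrite !EFinM -!gE green_reversible.
  - exact: xil2.
  - exists S => // v; rewrite -SE; apply: eq_esum => u _.
    by rewrite normrM ger0_norm.
exists k, C; split=> // xi xil2; have [S SE SB] := kS _ xil2.
  by move=> v; apply: rsummableE (SE v).
(* Pointwise, the operator is dominated by the sum [S v] of absolute values, which the Schur test
   controls. *)
apply: le_trans SB; apply: le_esum => v _; rewrite lee_fin ler_wpM2l//.
rewrite opE -real_normK ?num_real//.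
by apply: lerXn2r; rewrite ?nnegrE//; [apply: le_trans (ler_norm_rsum (SE v))|
  exact: ler_norm_rsum].
Qed.

Lemma green_bounded_rho_lt1 : green_bounded R G.
Proof.
have [k [C [C0 gE opE sk bound]]] := green_kernel.
have l2_op xi : in_l2 xi -> in_l2 (green_op xi).
  move=> xil2; apply: le_lt_trans (bound _ xil2) _.
  by rewrite in_l2E// -EFinM ltry.
split=> //.
- move=> xi xil2 v; rewrite (_ : (fun u => _) = fun u => (k v u * xi u)%:E).
    exact: sk.
  by apply/funext => u; rewrite gE.
- move=> a xi zeta xil2 zetal2; apply/funext => v; rewrite !opE.
  rewrite -rsumZ; last exact: sk.
  rewrite -rsumD; [|exact/rsummableZ/sk|exact: sk].
  by congr rsum; apply/funext => u; rewrite mulrDr mulrCA.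
- exists C => xi xil2; have := bound _ xil2.
  rewrite (in_l2E (l2_op _ xil2)) (in_l2E xil2) -EFinM lee_fin => le_op.
  rewrite /l2norm -[X in X * _](ger0_norm (ltW C0)) -sqrtr_sqr.
  by rewrite -sqrtrM ?sqr_ge0// ler_wsqrtr.
Qed.

(** [K = I + P K] applied to [xi]: the identity contributes [xi v] by [rsum_dirac], and [rsum_sum]
    handles the neighbours. *)
Lemma green_op_fixpoint xi v : in_l2 xi ->
  green_op xi v = xi v + \sum_(w \in nbrs v) step v w * green_op xi w.
Proof.
move=> xil2; have [k [C [C0 gE opE sk _]]] := green_kernel.
have kE u : k v u = (v == u)%:R + \sum_(w \in nbrs v) step v w * k w u.
  apply: EFin_inj; rewrite -gE green_rec EFinD; congr (_ + _)%E.
  by rewrite -fsumEFin; [apply: eq_fsbigr => w _; rewrite gE EFinM|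
    exact: finite_nbrs].
have finN := @finite_nbrs G v; rewrite (fsbig_finite _ _ finN)/=.
under eq_bigr do rewrite opE.
have [sd de] := rsum_dirac v xi.
have [ss se] :=
  rsum_sum (finmap.enum_fset (fset_set (nbrs v))) (step v) (sk _ xil2).
rewrite -se -de -rsumD// opE; congr rsum; apply/funext => u.
rewrite kE mulrDl (fsbig_finite _ _ finN)/= mulr_suml.
by congr (_ + _); apply: eq_bigr => w _; rewrite mulrA.
Qed.

End green_operator.

(** * The best response in the quadratic game *)

Lemma sum_sqr_min (R : realType) (I : Type) (s : seq I) (x : I -> R) (b a : R) :
  - (\sum_(i <- s) (b - x i)) * b + \sum_(i <- s) 2^-1 * (b - x i) ^+ 2 <=
  - (\sum_(i <- s) (b - x i)) * a + \sum_(i <- s) 2^-1 * (a - x i) ^+ 2.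
Proof.
rewrite -!sumrN !mulr_suml -!big_split/=; apply: ler_sum => i _.
(* In terms of [d = a - b] the linear terms cancel, and each summand on the right exceeds its
   counterpart by [d ^+ 2 / 2]. *)
have [d ->] : exists d, a = d + b by exists (a - b); rewrite subrK.
rewrite -[d + b - _]addrA; move: (b - x i) => y.
rewrite sqrrD -[d * y *+ 2]mulr_natl !mulrDr mulKf// !mulNr [d * y]mulrC.
rewrite [- (y * d) + _]addrC -addrA [_ + y * d]addrC -[y * d + _ + _]addrA.
rewrite addKr [_ * d ^+ 2 + _]addrC addrA.
by rewrite lerDl mulr_ge0 ?invr_ge0 ?sqr_ge0.
Qed.

Lemma ae_rootedS (R : realType) (mu : probability (Gstar R) R)
    (P Q : forall G : graph, G -> Prop) :
  (forall G o, P G o -> Q G o) -> ae_rooted mu P -> ae_rooted mu Q.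
Proof.
move=> PQ; apply: (@filterS _ (almost_everywhere mu)).
by move=> X PX G o XE; apply/PQ/PX.
Qed.

Lemma ae_rootedI (R : realType) (mu : probability (Gstar R) R)
    (P Q : forall G : graph, G -> Prop) :
  ae_rooted mu P -> ae_rooted mu Q -> ae_rooted mu (fun G o => P G o /\ Q G o).
Proof.
apply: (@filterS2 _ (almost_everywhere mu)).
by move=> X PX QX G o XE; split; [exact: PX|exact: QX].
Qed.

Theorem corollary4p2 (R : realType) (mu : probability (Gstar R) R) (D : nat)
    (eta : Gstar R -> R) :
  let xi (G : graph) (v : G) : R := eta (class1 v) / (deg v)%:R in
  unimodular mu ->
  ae_rooted mu (fun G o => (0 < deg o)%N) ->
  ae_rooted mu (fun G _ => forall v : G, (deg v <= D)%N) ->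
  eta \in Lfun mu 2%:E ->
  ae_rooted mu (fun G o => (rho R o o < 1)%E) ->
  ae_rooted mu (fun G _ => in_l2 (xi G)) ->
  ae_rooted mu (fun G _ => green_bounded R G) /\
  forall xstar : Gstar R -> R,
    xstar \in Lfun mu 2%:E ->
    ae_rooted mu (fun G _ => forall v : G,
      xstar (class1 v) = green_op (xi G) v) ->
    quenched_nash (fun X a => - eta X * a) (fun _ a b => 2^-1 * (a - b) ^+ 2)
      mu xstar.
Proof.
move=> xi _ ae_deg _ _ ae_rho ae_xi; split.
  apply: ae_rootedS (ae_rootedI ae_deg ae_rho) => G o [deg_o rho_o].
  exact: green_bounded_rho_lt1 deg_o rho_o.
move=> xstar xstarL ae_xstar; split=> //.
(* Intersecting the almost sure events leaves a deterministic claim about one rooted graph. *)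
have ae_all :=
  ae_rootedI (ae_rootedI ae_deg ae_rho) (ae_rootedI ae_xi ae_xstar).
apply: ae_rootedS ae_all.
move=> G o [[deg_o rho_o] [xil2 xsE]] a.
have finN := @finite_nbrs G o; pose s := finmap.enum_fset (fset_set (nbrs o)).
(* The first-order condition at the root: multiplying the fixed-point equation by [deg o] turns [xi]
   into [eta] and the average over neighbours into a sum. *)
have etaE :
    eta (class1 o) = \sum_(u <- s) (xstar (class1 o) - xstar (class1 u)).
  have := green_op_fixpoint deg_o rho_o o xil2.
  rewrite -xsE; under eq_fsbigr do rewrite -xsE.
  rewrite (fsbig_finite _ _ finN)/= sumrB big_const_seq count_predT iter_addr_0.
  have degE : size s = deg o by [].
  rewrite degE -mulr_natl => ->.
  rewrite mulrDr /xi mulrCA divff ?mulr1 ?pnatr_eq0 -?lt0n// mulr_sumr.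
  rewrite -addrA -sumrB big_seq big1 ?addr0// => u.
  rewrite in_fset_set// inE => ou.
  by rewrite mulrA deg_step ou mul1r subrr.
rewrite /cost /actions /= eqxx etaE !(fsbig_finite _ _ finN)/=.
(* A deviation of the root leaves its neighbours' actions unchanged, as there are no loops. *)
rewrite [X in _ <= _ + X](_ : _ =
    \sum_(u <- s) 2^-1 * (a - xstar (class1 u)) ^+ 2).
  exact: sum_sqr_min.
rewrite big_seq [RHS]big_seq; apply: eq_bigr => u.
rewrite in_fset_set// inE => ou; case: eqVneq => // uo.
by move: ou; rewrite uo /nbrs/= adj_irr.
Qed.
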